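(* Let $X$ be an irreducible complex algebraic variety, let $\mathcal{L}_1,\ldots,\mathcal{L}_k$ be globally generated line bundles on $X$, and for each $i$ let $E_i\subset H^0(X,\mathcal{L}_i)$ be a finite-dimensional base-point free linear series. Put $\mathbf{E}=E_1\times\cdots\times E_k$. Then the incidence variety $\widetilde R_{\mathbf E}\subset X\times\mathbf{E}$ and the consistency variety $R_{\mathbf E}\subset\mathbf{E}$ are irreducible algebraic varieties.
   Context: A linear series $E_i$ is base-point free if there is no $x\in X$ with $s(x)=0$ for all $s\in E_i$. The incidence variety is $\widetilde R_{\mathbf E}=\{(p,(s_1,\ldots,s_k))\in X\times\mathbf{E} : s_1(p)=\cdots=s_k(p)=0\}$. The consistency variety $R_{\mathbf E}$ is the Zariski closure in $\mathbf{E}$ of the image of $\widetilde R_{\mathbf E}$ under the projection $X\times\mathbf{E}\to\mathbf{E}$, i.e. the closure of the set of all systems having at least one common root on $X$. *)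

(* Defs.v *)
From HB Require Import structures.
From mathcomp Require Import all_boot all_order all_algebra.
From mathcomp Require Import boolp classical_sets functions filter reals topology.
From mathcomp Require mpoly complex.
(* Only the notations of these two files clash with the topology library. *)
Export -(notations) mpoly.
Export -(notations) complex.

Set Implicit Arguments.
Unset Strict Implicit.
Unset Printing Implicit Defensive.

Import GRing.Theory.
Local Open Scope classical_set_scope.
Local Open Scope ring_scope.

(* Varieties are treated classically, as topological spaces of closed points   *)
(* carrying a sheaf of K-valued functions.  The sheaf is encoded by its germs: *)
(* regular_at x f says that f is regular on some neighbourhood of x, so that   *)
(* O(U) consists of the f which are regular at every point of U; the sheaf     *)
(* axioms then hold by construction.  A function is always total, but only its *)
(* values near x matter for regular_at x.                                      *)
HB.mixin Record isSpaceWithFunctions (K : closedFieldType) X of Topological X := {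
  regular_at : X -> set (X -> K);
  regular_at_germ : forall (x : X) (f g : X -> K),
    (\forall y \near x, f y = g y) -> regular_at x f -> regular_at x g;
  regular_at_near : forall (x : X) (f : X -> K),
    regular_at x f -> \forall y \near x, regular_at y f;
  regular_at_cst : forall (x : X) (c : K), regular_at x (fun=> c);
  regular_atD : forall (x : X) (f g : X -> K),
    regular_at x f -> regular_at x g -> regular_at x (fun y => f y + g y);
  regular_atM : forall (x : X) (f g : X -> K),
    regular_at x f -> regular_at x g -> regular_at x (fun y => f y * g y);
  regular_at_neq0 : forall (x : X) (f : X -> K),
    regular_at x f -> f x != 0 -> \forall y \near x, f y != 0;
  regular_atV : forall (x : X) (f : X -> K),
    regular_at x f -> f x != 0 -> regular_at x (fun y => (f y)^-1)
}.

#[short(type="sfType")]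
HB.structure Definition SpaceWithFunctions (K : closedFieldType) :=
  {X of isSpaceWithFunctions K X & Topological X}.

Lemma near_all (T : topologicalType) (x : T) (P : T -> Prop) :
  (forall y, P y) -> \forall y \near x, P y.
Proof. by move=> PT; exact: nearW. Qed.

Section Fractions.
Variables (K : closedFieldType) (T : topologicalType) (B : T -> set (T -> K)).
Hypothesis B_near : forall x h, B x h -> \forall y \near x, B y h.
Hypothesis B_cst : forall x c, B x (fun=> c).
Hypothesis B_D : forall x f g, B x f -> B x g -> B x (fun y => f y + g y).
Hypothesis B_M : forall x f g, B x f -> B x g -> B x (fun y => f y * g y).
Hypothesis B_neq0 : forall x h, B x h -> h x != 0 -> \forall y \near x, h y != 0.

Definition fraction_at (x : T) : set (T -> K) := [set f |
  exists g h, [/\ B x g, B x h, h x != 0 &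
                  \forall y \near x, f y = g y / h y]].

Lemma fraction_at_germ x f g :
  (\forall y \near x, f y = g y) -> fraction_at x f -> fraction_at x g.
Proof.
move=> fg [a [b [Ba Bb bx fE]]]; exists a, b; split=> //.
by apply: filterS2 fg fE => y <-.
Qed.

Lemma fraction_at_near x f : fraction_at x f -> \forall y \near x, fraction_at y f.
Proof.
move=> [a [b [Ba Bb bx /near_join fE]]].
apply: filterS3 (filterI (B_near Ba) (B_near Bb)) (B_neq0 Bb bx) fE.
by move=> y [? ?] ? ?; exists a, b.
Qed.

Lemma fraction_at_cst x c : fraction_at x (fun=> c).
Proof.
exists (fun=> c), (fun=> 1); split=> //; rewrite ?oner_neq0 //.
by apply: near_all => y; rewrite divr1.
Qed.

Lemma fraction_atD x f g :
  fraction_at x f -> fraction_at x g -> fraction_at x (fun y => f y + g y).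
Proof.
move=> [a [b [Ba Bb bx fE]]] [c [d [Bc Bd dx gE]]].
exists (fun y => a y * d y + c y * b y), (fun y => b y * d y); split.
- by apply: B_D; apply: B_M.
- exact: B_M.
- by rewrite mulf_neq0.
apply: filterS3 (filterI fE gE) (B_neq0 Bb bx) (B_neq0 Bd dx).
by move=> y [-> ->] by0 dy0; rewrite addf_div.
Qed.

Lemma fraction_atM x f g :
  fraction_at x f -> fraction_at x g -> fraction_at x (fun y => f y * g y).
Proof.
move=> [a [b [Ba Bb bx fE]]] [c [d [Bc Bd dx gE]]].
exists (fun y => a y * c y), (fun y => b y * d y); split.
- exact: B_M.
- exact: B_M.
- by rewrite mulf_neq0.
by apply: filterS2 fE gE => y -> ->; rewrite mulf_div.
Qed.

Lemma fraction_at_neq0_num x f : fraction_at x f -> f x != 0 ->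
  exists g h, [/\ B x g, B x h, g x != 0, h x != 0 &
                  \forall y \near x, f y = g y / h y].
Proof.
move=> [a [b [Ba Bb bx fE]]] fx; exists a, b; split=> //.
by apply: contraNneq fx => ax; rewrite (nbhs_singleton fE) ax mul0r.
Qed.

Lemma fraction_at_neq0 x f :
  fraction_at x f -> f x != 0 -> \forall y \near x, f y != 0.
Proof.
move=> /fraction_at_neq0_num /[apply] -[a [b [Ba Bb ax bx fE]]].
apply: filterS3 fE (B_neq0 Ba ax) (B_neq0 Bb bx) => y -> ay0 by0.
by rewrite mulf_neq0 ?invr_eq0.
Qed.

Lemma fraction_atV x f :
  fraction_at x f -> f x != 0 -> fraction_at x (fun y => (f y)^-1).
Proof.
move=> /fraction_at_neq0_num /[apply] -[a [b [Ba Bb ax bx fE]]].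
exists b, a; split=> //.
by apply: filterS fE => y ->; rewrite invf_div.
Qed.

End Fractions.

(* The affine space underlying a finite-dimensional vector space V, with       *)
(* polynomials taken in the coordinates of the library's basis of V; another   *)
(* basis would give the same structure.  A^n is zariski 'rV[K]_n.              *)
Definition zariski (K : closedFieldType) (V : vectType K) : Type := V.

Section Zariski.
Variables (K : closedFieldType) (V : vectType K).
Implicit Types (p q : mpoly (\dim {:V}) K).

Definition poly_fun p : zariski V -> K := fun v =>
  meval (fun i => coord (vbasis {:V}) i (v : V)) p.

Definition zero_locus (P : set (mpoly (\dim {:V}) K)) : set (zariski V) :=
  [set v | forall p, P p -> poly_fun p v = 0].

Definition zariski_open (U : set (zariski V)) : Prop :=
  exists P, ~` U = zero_locus P.

Lemma zariski_openP U : zariski_open U <->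
  forall v, U v -> exists p, poly_fun p v != 0 /\
    forall w, poly_fun p w != 0 -> U w.
Proof.
split=> [[P UP] v Uv|H].
  have : ~ zero_locus P v by rewrite -UP; apply.
  move=> /existsNP[p /not_implyP[Pp /eqP pv]]; exists p; split=> // w pw.
  apply: contrapT => nUw; have : zero_locus P w by rewrite -UP.
  by move=> /(_ p Pp) /eqP; apply/negP.
exists [set p | forall w, ~ U w -> poly_fun p w = 0].
apply/seteqP; split=> [v nUv p|v vP Uv]; first exact.
have [p [pv pU]] := H v Uv.
move/eqP: pv; apply; apply: vP => w nUw.
by apply: contrapT => /eqP /pU.
Qed.

Lemma zariski_openT : zariski_open setT.
Proof.
apply/zariski_openP => v _; exists 1; split=> //.
by rewrite /poly_fun meval1 oner_neq0.
Qed.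

Lemma zariski_openI : setI_closed zariski_open.
Proof.
move=> A B /zariski_openP oA /zariski_openP oB; apply/zariski_openP.
move=> v [/oA[p [pv pA]] /oB[q [qv qB]]]; exists (p * q).
rewrite /poly_fun mevalM mulf_neq0 //; split=> // w.
by rewrite mevalM mulf_eq0 negb_or => /andP[/pA ? /qB ?].
Qed.

Lemma zariski_open_bigU (I : Type) (f : I -> set (zariski V)) :
  (forall i, zariski_open (f i)) -> zariski_open (\bigcup_i f i).
Proof.
move=> of_; apply/zariski_openP => v [i _ fv].
have /zariski_openP /(_ v fv)[p [pv pf]] := of_ i.
by exists p; split=> // w /pf; exists i.
Qed.

HB.instance Definition _ := Choice.copy (zariski V) V.
HB.instance Definition _ := isOpenTopological.Build (zariski V)
  zariski_openT zariski_openI zariski_open_bigU.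

Definition polynomial_at (v : zariski V) : set (zariski V -> K) :=
  [set f | exists p, f = poly_fun p].

Let polynomial_near v h : polynomial_at v h -> \forall w \near v, polynomial_at w h.
Proof. by move=> hp; apply: near_all. Qed.

Let polynomial_cst v c : polynomial_at v (fun=> c).
Proof. by exists (mpolyC _ c); apply/funext => w; rewrite /poly_fun mevalC. Qed.

Let polynomialD v f g : polynomial_at v f -> polynomial_at v g ->
  polynomial_at v (fun w => f w + g w).
Proof.
move=> [p ->] [q ->]; exists (p + q).
by apply/funext => w; rewrite /poly_fun mevalD.
Qed.

Let polynomialM v f g : polynomial_at v f -> polynomial_at v g ->
  polynomial_at v (fun w => f w * g w).
Proof.
move=> [p ->] [q ->]; exists (p * q).
by apply/funext => w; rewrite /poly_fun mevalM.
Qed.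

Let polynomial_neq0 v h : polynomial_at v h -> h v != 0 ->
  \forall w \near v, h w != 0.
Proof.
move=> [p ->] pv; apply: (@open_nbhs_nbhs _ _ [set w | poly_fun p w != 0]).
by split=> //; apply/zariski_openP => w pw; exists p.
Qed.

HB.instance Definition _ := @isSpaceWithFunctions.Build K (zariski V)
  (fraction_at polynomial_at)
  (@fraction_at_germ _ _ polynomial_at)
  (fraction_at_near polynomial_near polynomial_neq0)
  (fraction_at_cst polynomial_cst)
  (fraction_atD polynomialD polynomialM polynomial_neq0)
  (fraction_atM polynomialM)
  (fraction_at_neq0 polynomial_neq0)
  (fraction_atV (B := polynomial_at)).

End Zariski.

(* The structure induced on an arbitrary subset, the topology being the one    *)
(* the library puts on set_type.                                               *)
Section Induced.
Variables (K : closedFieldType) (X : sfType K) (S : set X).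

Definition induced_regular_at (x : set_type S) : set (set_type S -> K) :=
  [set f | exists g : X -> K, regular_at (set_val x) g /\
     \forall y \near x, f y = g (set_val y)].

Let pullback_near (x : set_type S) (P : set X) :
  (\forall y \near set_val x, P y) -> \forall y \near x, P (set_val y).
Proof. by move=> xP; apply: (@initial_continuous (set_type S) X set_val x P xP). Qed.

Let ind_germ x f g : (\forall y \near x, f y = g y) ->
  induced_regular_at x f -> induced_regular_at x g.
Proof.
move=> fg [h [rh fE]]; exists h; split=> //.
by apply: filterS2 fg fE => y <-.
Qed.

Let ind_near x f : induced_regular_at x f ->
  \forall y \near x, induced_regular_at y f.
Proof.
move=> [h [/regular_at_near/pullback_near rh /near_join fE]].
by apply: filterS2 rh fE => y ? ?; exists h.
Qed.

Let ind_cst x c : induced_regular_at x (fun=> c).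
Proof.
by exists (fun=> c); split; [exact: regular_at_cst | exact: near_all].
Qed.

Let indD x f g : induced_regular_at x f -> induced_regular_at x g ->
  induced_regular_at x (fun y => f y + g y).
Proof.
move=> [a [ra fE]] [b [rb gE]]; exists (fun y => a y + b y); split.
  exact: regular_atD.
by apply: filterS2 fE gE => y -> ->.
Qed.

Let indM x f g : induced_regular_at x f -> induced_regular_at x g ->
  induced_regular_at x (fun y => f y * g y).
Proof.
move=> [a [ra fE]] [b [rb gE]]; exists (fun y => a y * b y); split.
  exact: regular_atM.
by apply: filterS2 fE gE => y -> ->.
Qed.

Let ind_neq0 x f : induced_regular_at x f -> f x != 0 ->
  \forall y \near x, f y != 0.
Proof.
move=> [a [ra fE]]; rewrite (nbhs_singleton fE) => ax.
have := pullback_near (regular_at_neq0 _ _ ra ax).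
by apply: filterS2 fE => y ->.
Qed.

Let indV x f : induced_regular_at x f -> f x != 0 ->
  induced_regular_at x (fun y => (f y)^-1).
Proof.
move=> [a [ra fE]]; rewrite (nbhs_singleton fE) => ax.
exists (fun y => (a y)^-1); split; first exact: regular_atV.
by apply: filterS fE => y ->.
Qed.

HB.instance Definition _ := @isSpaceWithFunctions.Build K (set_type S)
  induced_regular_at ind_germ ind_near ind_cst indD indM ind_neq0 indV.

End Induced.

(* The product in the category of spaces with functions: its topology is finer *)
(* than the product topology, being generated by the sets                      *)
(* {(x, y) in U x V | sum_i a_i(x) b_i(y) <> 0} with a_i in O(U), b_i in O(V), *)
(* and its regular functions are locally quotients of such sums.               *)
Definition zprod (K : closedFieldType) (X Y : sfType K) : Type := (X * Y)%type.

Section Product.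
Variables (K : closedFieldType) (X Y : sfType K).
Local Notation XY := (zprod X Y).

Definition tensor_at (z : XY) : set (XY -> K) := [set h |
  exists (I : finType) (a : I -> X -> K) (b : I -> Y -> K),
    [/\ forall i, regular_at z.1 (a i), forall i, regular_at z.2 (b i) &
        h = fun w => \sum_i a i w.1 * b i w.2]].

Definition zprod_open (W : set XY) : Prop := forall z, W z ->
  exists (U : set X) (V : set Y) (h : XY -> K),
    [/\ nbhs z.1 U, nbhs z.2 V, tensor_at z h, h z != 0 &
        forall w, U w.1 -> V w.2 -> h w != 0 -> W w].

Lemma tensor_cst z c : tensor_at z (fun=> c).
Proof.
exists unit, (fun _ _ => c), (fun _ _ => 1); split=> [_|_|].
- exact: regular_at_cst.
- exact: regular_at_cst.
by apply/funext => w; rewrite big_const card_unit /= mulr1 addr0.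
Qed.

Lemma tensorD z f g : tensor_at z f -> tensor_at z g ->
  tensor_at z (fun w => f w + g w).
Proof.
move=> [I [a [b [ra rb ->]]]] [J [c [d [rc rd ->]]]].
exists (I + J)%type, (fun k => match k with inl i => a i | inr j => c j end),
  (fun k => match k with inl i => b i | inr j => d j end).
by split=> [[i|j]|[i|j]|] //; apply/funext => w; rewrite big_sumType.
Qed.

Lemma tensorM z f g : tensor_at z f -> tensor_at z g ->
  tensor_at z (fun w => f w * g w).
Proof.
move=> [I [a [b [ra rb ->]]]] [J [c [d [rc rd ->]]]].
exists (I * J)%type, (fun k x => a k.1 x * c k.2 x), (fun k y => b k.1 y * d k.2 y).
split=> [k|k|]; [exact: regular_atM|exact: regular_atM|].
apply/funext => w; rewrite big_distrlr /= pair_big /=.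
by apply: eq_bigr => k _; rewrite mulrACA.
Qed.

Lemma zprod_openT : zprod_open setT.
Proof.
move=> z _; exists setT, setT, (fun=> 1); split=> //; try exact: filterT.
- exact: tensor_cst.
- exact: oner_neq0.
Qed.

Lemma zprod_openI : setI_closed zprod_open.
Proof.
move=> A B oA oB z [/oA[U [V [h [? ? ? ? hA]]]] /oB[U' [V' [h' [? ? ? ? hB]]]]].
exists (U `&` U'), (V `&` V'), (fun w => h w * h' w); split.
- exact: filterI.
- exact: filterI.
- exact: tensorM.
- by rewrite mulf_neq0.
move=> w [? ?] [? ?]; rewrite mulf_eq0 negb_or => /andP[? ?].
by split; [apply: hA|apply: hB].
Qed.

Lemma zprod_open_bigU (I : Type) (f : I -> set XY) :
  (forall i, zprod_open (f i)) -> zprod_open (\bigcup_i f i).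
Proof.
move=> of_ z [i _ /of_[U [V [h [? ? ? ? hf]]]]].
by exists U, V, h; split=> // w ? ? ?; exists i => //; apply: hf.
Qed.

HB.instance Definition _ := Choice.copy XY (X * Y)%type.
HB.instance Definition _ := isOpenTopological.Build XY
  zprod_openT zprod_openI zprod_open_bigU.

Lemma zprod_near (z : XY) (U : set X) (V : set Y) :
  nbhs z.1 U -> nbhs z.2 V -> \forall w \near z, U w.1 /\ V w.2.
Proof.
move=> zU zV.
apply: (@filterS _ _ _ [set w : XY | U^° w.1 /\ V^° w.2]); last first.
  apply: open_nbhs_nbhs; split; last by [].
  move=> w [wU wV]; exists U^°, V^°, (fun=> 1); split=> //.
  - exact: nbhs_interior.
  - exact: nbhs_interior.
  - exact: tensor_cst.
  - exact: oner_neq0.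
by move=> w [/interior_subset ? /interior_subset ?].
Qed.

Let tensor_near z h : tensor_at z h -> \forall w \near z, tensor_at w h.
Proof.
move=> [I [a [b [ra rb ->]]]].
have na : \forall x \near z.1, forall i, regular_at x (a i).
  by apply: filter_forall => i; apply: regular_at_near.
have nb : \forall y \near z.2, forall i, regular_at y (b i).
  by apply: filter_forall => i; apply: regular_at_near.
by apply: filterS (zprod_near na nb) => w [? ?]; exists I, a, b.
Qed.

Let tensor_neq0 z h : tensor_at z h -> h z != 0 -> \forall w \near z, h w != 0.
Proof.
move=> th hz; have [I [a [b [ra rb hE]]]] := th.
have na : \forall x \near z.1, forall i, regular_at x (a i).
  by apply: filter_forall => i; apply: regular_at_near.
have nb : \forall y \near z.2, forall i, regular_at y (b i).
  by apply: filter_forall => i; apply: regular_at_near.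
apply: (@filterS _ _ _ [set w : XY | [/\
  [set x | forall i, regular_at x (a i)]^° w.1,
  [set y | forall i, regular_at y (b i)]^° w.2 & h w != 0]]); first by move=> w [].
apply: open_nbhs_nbhs; split; last by split=> //; exact: nbhs_singleton.
move=> w [wa wb hw]; do 3!eexists; split;
  [exact: nbhs_interior wa|exact: nbhs_interior wb| |exact: hw|by []].
by exists I, a, b; split=> // i; [exact: (interior_subset wa)|
  exact: (interior_subset wb)].
Qed.

HB.instance Definition _ := @isSpaceWithFunctions.Build K XY
  (fraction_at tensor_at)
  (@fraction_at_germ _ _ tensor_at)
  (fraction_at_near tensor_near tensor_neq0)
  (fraction_at_cst tensor_cst)
  (fraction_atD tensorD tensorM tensor_neq0)
  (fraction_atM tensorM)
  (fraction_at_neq0 tensor_neq0)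
  (fraction_atV (B := tensor_at)).

End Product.

Section Varieties.
Variable K : closedFieldType.

Definition sf_morphism (X Y : sfType K) (f : X -> Y) : Prop :=
  continuous f /\
  forall (x : X) (g : Y -> K), regular_at (f x) g -> regular_at x (g \o f).

Definition sf_isomorphic (X Y : sfType K) : Prop :=
  exists (f : X -> Y) (g : Y -> X),
    [/\ sf_morphism f, sf_morphism g, cancel f g & cancel g f].

Definition affine_variety (X : sfType K) : Prop :=
  exists (n : nat) (S : set (zariski 'rV[K]_n)),
    closed S /\ sf_isomorphic X (set_type S).

Definition prevariety (X : sfType K) : Prop :=
  exists (n : nat) (U : 'I_n -> set X),
    [/\ forall i, open (U i), \bigcup_i U i = setT &
        forall i, affine_variety (set_type (U i))].

Definition separated_space (X : sfType K) : Prop :=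
  closed [set z : zprod X X | z.1 = z.2].

Definition variety (X : sfType K) : Prop := prevariety X /\ separated_space X.

Definition irreducible_space (T : topologicalType) : Prop :=
  [set: T] !=set0 /\
  forall A B : set T, closed A -> closed B -> A `|` B = setT ->
    A = setT \/ B = setT.

Definition irreducible_variety (X : sfType K) : Prop :=
  variety X /\ irreducible_space X.

Definition irreducible_subvariety (X : sfType K) (S : set X) : Prop :=
  closed S /\ irreducible_variety (set_type S).

End Varieties.

Definition depfun (I : Type) (T : I -> Type) : Type := forall i, T i.

Section DepfunLmod.
Variables (K : fieldType) (I : Type) (V : I -> lmodType K).
Local Notation F := (depfun (fun i => V i)).

HB.instance Definition _ := Choice.copy F (forall i, V i).

Definition depfun_zero : F := fun=> 0.
Definition depfun_opp (f : F) : F := fun i => - f i.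
Definition depfun_add (f g : F) : F := fun i => f i + g i.
Definition depfun_scale (c : K) (f : F) : F := fun i => c *: f i.

Let addA : associative depfun_add.
Proof. by move=> f g h; apply: functional_extensionality_dep => i; exact: addrA. Qed.
Let addC : commutative depfun_add.
Proof. by move=> f g; apply: functional_extensionality_dep => i; exact: addrC. Qed.
Let add0 : left_id depfun_zero depfun_add.
Proof. by move=> f; apply: functional_extensionality_dep => i; exact: add0r. Qed.
Let addN : left_inverse depfun_zero depfun_opp depfun_add.
Proof. by move=> f; apply: functional_extensionality_dep => i; exact: addNr. Qed.

HB.instance Definition _ := GRing.isZmodule.Build F addA addC add0 addN.

Let scaleA c d f : depfun_scale c (depfun_scale d f) = depfun_scale (c * d) f.
Proof. by apply: functional_extensionality_dep => i; exact: scalerA. Qed.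
Let scale1 : left_id 1 depfun_scale.
Proof. by move=> f; apply: functional_extensionality_dep => i; exact: scale1r. Qed.
Let scaleDr : right_distributive depfun_scale +%R.
Proof. by move=> c f g; apply: functional_extensionality_dep => i; exact: scalerDr. Qed.
Let scaleDl f : {morph depfun_scale^~ f : c d / c + d}.
Proof. by move=> c d; apply: functional_extensionality_dep => i; exact: scalerDl. Qed.

HB.instance Definition _ :=
  GRing.Zmodule_isLmodule.Build K F scaleA scale1 scaleDr scaleDl.

End DepfunLmod.

Section DepfunVect.
Variables (K : fieldType) (I : finType) (V : I -> vectType K).
Local Notation F := (depfun (fun i => V i)).
Import VectorInternalTheory.

Fact depfun_vect_iso :
  Vector.axiom (\sum_(i < #|I|) dim (V (enum_val i))) F.
Proof.
pose to (f : F) : 'rV[K]_(\sum_(i < #|I|) dim (V (enum_val i))) :=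
  \mxrow_(i < #|I|) v2r (f (enum_val i)).
exists to.
  move=> c f g; apply/rowP => j.
  by rewrite !mxE /= linearP !mxE.
pose ca i : V (enum_val (enum_rank i)) -> V i :=
  fun v => ecast j (V j) (enum_rankK i) v.
pose from (r : 'rV[K]_(\sum_(i < #|I|) dim (V (enum_val i)))) : F :=
  fun i => ca i (r2v (submxrow r (enum_rank i))).
have castE (f : F) i j (e : i = j) : ecast k (V k) e (f i) = f j by case: _ / e.
exists from => [f|r].
  apply: functional_extensionality_dep => i.
  by rewrite /from /to mxrowK v2rK; exact: castE.
rewrite -[RHS](submxrowK r); apply: eq_mxrow => i; rewrite /from /ca.
pose G (k : 'I_#|I|) : V (enum_val k) := r2v (submxrow r k).
have H k (e : enum_val k = enum_val i) : ecast j (V j) e (G k) = G i.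
  have ki := enum_val_inj e; case: _ / ki e => e.
  by rewrite (eq_irrelevance e erefl).
by rewrite (H _ (enum_rankK (enum_val i))) r2vK.
Qed.

HB.instance Definition _ := Lmodule_hasFinDim.Build K F depfun_vect_iso.

End DepfunVect.

(* A line bundle, given by its fibres and an atlas of local trivializations    *)
(* whose transition functions are regular.  Outside trivial_on a the map       *)
(* triv a x is irrelevant.                                                     *)
Record line_bundle (K : closedFieldType) (X : sfType K) := LineBundle {
  fiber :> X -> lmodType K;
  chart : Type;
  trivial_on : chart -> set X;
  triv : forall (a : chart) (x : X), {linear fiber x -> K^o};
  trivial_on_open : forall a, open (trivial_on a);
  trivial_on_cover : \bigcup_a trivial_on a = setT;
  triv_bij : forall a x, trivial_on a x -> bijective (triv a x);
  triv_regular : forall a b x, trivial_on a x -> trivial_on b x ->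
    exists g : X -> K, regular_at x g /\
      \forall y \near x, forall v : fiber y, triv a y v = g y * triv b y v
}.

Section GlobalSections.
Variables (K : closedFieldType) (X : sfType K) (L : line_bundle X).

Definition global_section : {pred depfun (fun x => L x)} := fun s =>
  `[< forall (a : chart L) (x : X), trivial_on a x ->
        regular_at x (fun y => triv a y (s y) : K) >].

Fact global_section_submod : submod_closed global_section.
Proof.
split=> [|c s t /asboolP rs /asboolP rt]; apply/asboolP => a x ax.
  apply: (regular_at_germ _ _ _ _ (regular_at_cst x 0)).
  by apply: near_all => y; rewrite -[0](linear0 (triv a y)).
apply: (regular_at_germ _ _ _ _ (regular_atD _ _ _
  (regular_atM _ _ _ (regular_at_cst x c) (rs a x ax)) (rt a x ax))).
by apply: near_all => y; rewrite -[RHS]/(triv a y (c *: s y + t y)) linearP.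
Qed.

HB.instance Definition _ :=
  GRing.isSubmodClosed.Build K _ global_section global_section_submod.

Record H0 := GlobalSection {
  section_fun : depfun (fun x => L x);
  section_regular : section_fun \in global_section
}.

HB.instance Definition _ := [isSub for section_fun].
HB.instance Definition _ := [Choice of H0 by <:].
HB.instance Definition _ := [SubChoice_isSubLmodule of H0 by <:].

Definition section_eval (s : H0) (x : X) : L x := section_fun s x.
Coercion section_eval : H0 >-> Funclass.

Definition globally_generated : Prop :=
  forall (x : X) (v : L x), exists s : H0, s x = v.

(* A finite-dimensional subspace of H0, presented as a finite-dimensional      *)
(* space with an injective linear map to H0.                                   *)
Record linear_series := LinearSeries {
  series_space :> vectType K;
  series_incl : {linear series_space -> H0};
  series_incl_inj : injective series_incl
}.

Definition base_point_free (E : linear_series) : Prop :=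
  ~ exists x : X, forall s : E, series_incl E s x = 0.

End GlobalSections.

Section Incidence.
Variables (K : closedFieldType) (X : sfType K) (k : nat).
Variables (L : 'I_k -> line_bundle X) (E : forall i, linear_series (L i)).

Definition system_space : vectType K := depfun (fun i => E i).

Definition incidence_variety : set (zprod X (zariski system_space)) :=
  [set z | forall i, series_incl (E i) ((z.2 : depfun (fun i => E i)) i) z.1 = 0].

Definition consistency_variety : set (zariski system_space) :=
  closure (snd @` incidence_variety).

End Incidence.

Arguments system_space {K X k L} E.
Arguments incidence_variety {K X k L} E.
Arguments consistency_variety {K X k L} E.

(* Main.v *)
Require Import Defs.
From HB Require Import structures.
From mathcomp Require Import all_boot all_order all_algebra.
From mathcomp Require Import boolp classical_sets functions filter reals topology.
From mathcomp Require mpoly complex.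

Set Implicit Arguments.
Unset Strict Implicit.
Unset Printing Implicit Defensive.

Import GRing.Theory.
Local Open Scope classical_set_scope.
Local Open Scope ring_scope.

(** Over a point x of X the systems vanishing at x form the kernel of the
    evaluation map from the product of the E_i to the product of the fibres of
    the L_i at x, so the incidence variety is a family of vector spaces over X.
    Base-point freeness makes every evaluation surjective, hence the dimension
    of these kernels constant and the family a vector bundle; the total space of
    a vector bundle over an irreducible base is irreducible.

    Only a weak form of local triviality is needed: through every point (x, v) of
    the incidence variety there passes a local section.  Choose e_i in E_i not
    vanishing at x; in a trivialization of L_i around x,
      y |-> v_i - (v_i(y) / e_i(y)) e_i
    is a regular family of elements of E_i, each vanishing at y, whose value at x
    is v_i.  Hence the projection to X is open on the incidence variety
    (incidence_projection_open).  An open map with irreducible base and irreducible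
    fibres has an irreducible source (irreducible_fibration): two nonempty open
    sets have open images, which meet in some b, and above b both cut the
    irreducible fibre.  The fibres are irreducible because any two of their points
    lie on a line (incidence_fiber_irreducible, zariski_irreducible).  The
    consistency variety is the closure of a continuous image of the incidence
    variety, so it is irreducible as well.

    The other half of the claim is that both sets are varieties.  The incidence
    variety is closed, because in a chart v_i(y) is a regular function of (y, v)
    (incidence_closed).  So what is needed is that affine spaces are varieties and
    that products and closed subspaces of varieties are varieties.  For the
    existence of affine charts this rests on one notion, that of an embedding, a
    map whose source carries the structure induced from its target: a space is
    affine as soon as it embeds with closed range into an affine one
    (embedding_affine), embeddings are stable under products (embedding_prod), and
    the product of two affine spaces is an affine space because the two have the
    same universal property (zprod_zariski). *)

(** * Morphisms of spaces with functions, point by point *)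

Lemma open_nbhsP (T : topologicalType) (A : set T) :
  open A <-> forall x, A x -> nbhs x A.
Proof. by rewrite openE. Qed.

Section Morphisms.
Variable K : closedFieldType.
Implicit Types X Y Z : sfType K.

(** Local sections of the incidence variety are defined and regular only near one
    point, so the two conditions on a morphism are imposed at a single point. *)
Definition morphism_at X Y (f : X -> Y) (x : X) : Prop :=
  {for x, continuous f} /\
  forall g : Y -> K, regular_at (f x) g -> regular_at x (g \o f).

Lemma sf_morphismP X Y (f : X -> Y) :
  sf_morphism f <-> forall x, morphism_at f x.
Proof.
split=> [[cf rf] x|mf]; first by split; [exact: cf|exact: rf].
by split=> x; have [] := mf x.
Qed.

Lemma morphism_at_cst X Y (y : Y) (x : X) : morphism_at (fun=> y) x.
Proof.
split; first exact: cvg_cst.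
by move=> g _; exact: regular_at_cst.
Qed.

Lemma morphism_at_id X (x : X) : morphism_at id x.
Proof. by split=> //; exact: cvg_id. Qed.

Lemma morphism_at_comp X Y Z (f : X -> Y) (g : Y -> Z) x :
  morphism_at f x -> morphism_at g (f x) -> morphism_at (g \o f) x.
Proof.
move=> [cf rf] [cg rg]; split; first exact: continuous_comp.
by move=> h /rg/rf.
Qed.

Lemma regular_at_sum X (x : X) (I : Type) (r : seq I) (F : I -> X -> K) :
  (forall i, regular_at x (F i)) -> regular_at x (fun y => \sum_(i <- r) F i y).
Proof.
move=> rF; elim: r => [|i r IH].
  apply: (regular_at_germ _ _ _ _ (regular_at_cst x 0)).
  by apply: near_all => y; rewrite big_nil.
apply: (regular_at_germ _ _ _ _ (regular_atD _ _ _ (rF i) IH)).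
by apply: near_all => y; rewrite big_cons.
Qed.

Lemma regular_at_prod X (x : X) (I : Type) (r : seq I) (F : I -> X -> K) :
  (forall i, regular_at x (F i)) -> regular_at x (fun y => \prod_(i <- r) F i y).
Proof.
move=> rF; elim: r => [|i r IH].
  apply: (regular_at_germ _ _ _ _ (regular_at_cst x 1)).
  by apply: near_all => y; rewrite big_nil.
apply: (regular_at_germ _ _ _ _ (regular_atM _ _ _ (rF i) IH)).
by apply: near_all => y; rewrite big_cons.
Qed.

Lemma regular_at_exp X (x : X) (F : X -> K) n :
  regular_at x F -> regular_at x (fun y => F y ^+ n).
Proof.
move=> rF; elim: n => [|n IH].
  exact: regular_at_cst.
apply: (regular_at_germ _ _ _ _ (regular_atM _ _ _ rF IH)).
by apply: near_all => y; rewrite exprS.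
Qed.

(** Regular functions are closed under the ring operations, hence under the
    evaluation of polynomials. *)
Lemma regular_at_meval X (x : X) n (F : 'I_n -> X -> K) (p : mpoly n K) :
  (forall i, regular_at x (F i)) ->
  regular_at x (fun y => meval (F^~ y) p).
Proof.
move=> rF; apply: (regular_at_germ _ (fun y => \sum_(m <- msupp p)
    mcoeff m p * \prod_i F i y ^+ fun_of_multinom m i)).
  by apply: near_all => y; rewrite mevalE.
apply: regular_at_sum => m; apply: regular_atM; first exact: regular_at_cst.
by apply: regular_at_prod => i; exact: regular_at_exp.
Qed.

(** * Embeddings *)

(** An isomorphism onto the range, expressed on the source alone: the topology and
    the regular functions are those pulled back along f.  This avoids a subtype for
    the range, so that chains of induced structures compose as maps. *)
Definition sf_embedding X Y (f : X -> Y) : Prop :=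
  [/\ injective f,
      forall x U, nbhs x U <-> exists2 V, nbhs (f x) V & f @^-1` V `<=` U &
      forall x g, regular_at x g <->
        exists2 h, regular_at (f x) h & \forall y \near x, g y = h (f y)].

Lemma embedding_morphism_at X Y (f : X -> Y) x : sf_embedding f -> morphism_at f x.
Proof.
move=> [_ nf rf]; split=> [V fV|g rg].
  by rewrite /nbhs/=; apply/nf; exists V.
by apply/rf; exists g => //; exact: near_all.
Qed.

Lemma set_val_embedding X (S : set X) : sf_embedding (@set_val X S).
Proof.
split=> [x y /val_inj //|x U|x g]; last first.
  by split=> [[h [rh gh]]|[h rh gh]]; exists h.
split=> [|[V xV VU]].
  rewrite nbhsE => -[B [[C oC <-] Cx] CU].
  by exists C => //; exact: open_nbhs_nbhs.
by apply: filterS VU _; exact: (@initial_continuous (set_type S) X set_val x V xV).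
Qed.

Lemma embedding_comp X Y Z (f : X -> Y) (g : Y -> Z) :
  sf_embedding f -> sf_embedding g -> sf_embedding (g \o f).
Proof.
move=> ef eg; have [fi nf rf] := ef; have [gi ng rg] := eg.
split=> [|x U|x h]; first exact: inj_comp.
  split=> [/nf[V /ng[W gW WV] VU]|[W gW WU]].
    by exists W => // y /WV /VU.
  by apply/nf; exists (g @^-1` W) => //; apply/ng; exists W.
split=> [/rf[a /rg[b rb ab] ha]|[b rb hb]].
  exists b => //; have [cf _] := embedding_morphism_at x ef.
  by apply: filterS2 ha (cf _ ab) => y -> /= ->.
by apply/rf; exists (b \o g) => //; apply/rg; exists b => //; exact: near_all.
Qed.

(** This is how two spaces embedded in the same Z are compared: when the range of
    one embedding lies in the range of the other, the map between the sources
    given by sub_range_factor is an embedding.  In particular induced structures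
    on nested subsets agree. *)
Lemma embedding_factor X Y Z (f : X -> Y) (g : Y -> Z) :
  sf_embedding g -> sf_embedding (g \o f) -> sf_embedding f.
Proof.
move=> eg egf; have [gi ng rg] := eg; have [gfi ngf rgf] := egf.
have nf x U : nbhs x U <-> exists2 V, nbhs (f x) V & f @^-1` V `<=` U.
  split=> [/ngf[W gW WU]|[V /ng[W gW WV] VU]].
    by exists (g @^-1` W) => //; apply/ng; exists W.
  by apply/ngf; exists W => // y /WV /VU.
split=> [x y e|//|x h]; first by apply: gfi; rewrite /= e.
split=> [/rgf[b rb hb]|[a /rg[b rb ab] ha]].
  by exists (b \o g) => //; apply/rg; exists b => //; exact: near_all.
apply/rgf; exists b => //.
have fab : nbhs x [set y | a (f y) = b (g (f y))].
  by apply/nf; exists [set z | a z = b (g z)].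
by apply: filterS2 ha fab => y ->.
Qed.

Lemma sub_range_factor (A B C : Type) (f : A -> C) (g : B -> C) :
  range f `<=` range g -> exists h : A -> B, g \o h = f.
Proof.
move=> fg; have /choice[h hE] : forall a, exists b, g b = f a.
  move=> a; have [|b _ gb] := fg (f a); first by exists a.
  by exists b.
by exists h; apply/funext => a /=; rewrite hE.
Qed.

Lemma isomorphic_embedding X Y : sf_isomorphic X Y ->
  exists2 f : X -> Y, sf_embedding f & range f = setT.
Proof.
move=> [f [g [[cf rf] [cg rg] fK gK]]]; exists f; last first.
  by apply/seteqP; split=> // y _; exists (g y).
split=> [|x U|x h]; first exact: can_inj fK.
  split=> [xU|[V fV VU]]; last by apply: filterS VU _; exact: cf.
  exists (g @^-1` U); first by apply: cg; rewrite fK.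
  by move=> y; rewrite /preimage /= fK.
split=> [rh|[a ra ha]].
  exists (h \o g); first by apply: rg; rewrite fK.
  by apply: near_all => y /=; rewrite fK.
by apply: (regular_at_germ _ _ _ _ (rf _ _ ra)); apply: filterS ha.
Qed.

(** For a bijective embedding, pulling back along the inverse recovers the
    neighbourhoods and the germs of the target. *)
Lemma embedding_isomorphic X Y (f : X -> Y) :
  sf_embedding f -> range f = setT -> sf_isomorphic X Y.
Proof.
move=> ef fT; have [fi nf rf] := ef.
have /sub_range_factor[g gE] : range (@id Y) `<=` range f by rewrite fT.
have gK : cancel g f by move=> y; exact: (congr1 (fun u => u y) gE).
have fK : cancel f g by move=> x; apply: fi; rewrite gK.
exists f, g; split=> //; first by apply/sf_morphismP => x; exact: embedding_morphism_at.
split=> [y U|y h].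
  move=> /nf[V]; rewrite gK => yV VU; apply: filterS yV => z Vz.
  by apply: VU; rewrite /preimage/= gK.
move=> /rf[a]; rewrite gK => ra /nf[V]; rewrite gK => yV aV.
apply: (regular_at_germ _ _ _ _ ra); apply: filterS yV => z Vz /=.
by rewrite (aV (g z)) ?gK // /preimage /= gK.
Qed.

Lemma range_set_val (T : Type) (S : set T) : range (@set_val T S) = S.
Proof.
apply/seteqP; split=> [_ [x _ <-]|x Sx]; first exact: set_valP.
by exists (SigSub (mem_set Sx)).
Qed.

Lemma embedding_isomorphic_range X Y (f : X -> Y) :
  sf_embedding f -> sf_isomorphic X (set_type (range f)).
Proof.
move=> ef; have [h hE] : exists h : X -> set_type (range f), set_val \o h = f.
  by apply: sub_range_factor; rewrite range_set_val.
apply: (@embedding_isomorphic _ _ h).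
  by apply: (embedding_factor (set_val_embedding _)); rewrite hE.
apply/seteqP; split=> // y _; have [x _ xy] := set_valP y.
by exists x => //; apply: val_inj; rewrite -[LHS]/((set_val \o h) x) hE.
Qed.

Lemma affine_varietyP X : affine_variety X <->
  exists (n : nat) (f : X -> zariski 'rV[K]_n), sf_embedding f /\ closed (range f).
Proof.
split=> [[n [S [cS /isomorphic_embedding[f ef fT]]]]|[n [f [ef cf]]]].
  exists n, (set_val \o f); split; first exact: embedding_comp (set_val_embedding _).
  by rewrite -(image_comp f set_val) fT range_set_val.
by exists n, (range f); split=> //; exact: embedding_isomorphic_range.
Qed.

(** Off the closed range there is nothing to avoid; at a point of the range,
    a neighbourhood avoiding A upstairs is the trace of one downstairs. *)
Lemma embedding_closed X Y (f : X -> Y) (A : set X) :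
  sf_embedding f -> closed (range f) -> closed A -> closed (f @` A).
Proof.
move=> [fi nf _] cf cA; rewrite -[f @` A]setCK; apply: open_closedC.
apply/open_nbhsP => y nAy; have [[x _ xy]|nfy] := pselect (range f y); last first.
  have : nbhs y (~` range f).
    by apply: open_nbhs_nbhs; split=> //; exact: closed_openC.
  by apply: filterS => z nz [x _ xz]; apply: nz; exists x.
have /nf[V] : nbhs x (~` A).
  apply: open_nbhs_nbhs; split; first exact: closed_openC.
  by move=> Ax; apply: nAy; exists x.
rewrite xy => yV VA; apply: filterS yV => z Vz [t At tz].
have Vt : V (f t) by rewrite tz.
exact: VA At.
Qed.

Lemma embedding_affine X Y (f : X -> Y) :
  sf_embedding f -> closed (range f) -> affine_variety Y -> affine_variety X.
Proof.
move=> ef cf /affine_varietyP[n [g [eg cg]]]; apply/affine_varietyP.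
exists n, (g \o f); split; first exact: embedding_comp.
by rewrite -(image_comp f g); exact: embedding_closed.
Qed.

End Morphisms.

(** * Products *)

Section Products.
Variable K : closedFieldType.
Implicit Types X Y Z : sfType K.

Lemma tensor_regular X Y (z : zprod X Y) h : tensor_at z h -> regular_at z h.
Proof.
move=> th; exists h, (fun=> 1); split=> //; first exact: tensor_cst.
  exact: oner_neq0.
by apply: near_all => w; rewrite divr1.
Qed.

Lemma fst_morphism_at X Y (z : zprod X Y) : morphism_at (fst : zprod X Y -> X) z.
Proof.
split=> [U zU|g rg].
  by apply: filterS (zprod_near zU (filterT : nbhs z.2 setT)) => w [].
apply: tensor_regular; exists unit, (fun=> g), (fun=> (fun=> 1)).
split=> // [_|]; first exact: regular_at_cst.
by apply/funext => w; rewrite big_const card_unit /= mulr1 addr0.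
Qed.

Lemma snd_morphism_at X Y (z : zprod X Y) : morphism_at (snd : zprod X Y -> Y) z.
Proof.
split=> [V zV|g rg].
  by apply: filterS (zprod_near (filterT : nbhs z.1 setT) zV) => w [].
apply: tensor_regular; exists unit, (fun=> (fun=> 1)), (fun=> g).
split=> // [_|]; first exact: regular_at_cst.
by apply/funext => w; rewrite big_const card_unit /= mul1r addr0.
Qed.

(** The basic sets of the definition of the topology are themselves
    neighbourhoods, since tensors are regular on the product. *)
Lemma zprod_nbhsP X Y (z : zprod X Y) (W : set (zprod X Y)) :
  nbhs z W <-> exists (U : set X) (V : set Y) (h : zprod X Y -> K),
    [/\ nbhs z.1 U, nbhs z.2 V, tensor_at z h, h z != 0 &
        forall w, U w.1 -> V w.2 -> h w != 0 -> W w].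
Proof.
split=> [|[U [V [h [zU zV th hz UVW]]]]].
  rewrite nbhsE => -[B [oB Bz] BW].
  have [U [V [h [zU zV th hz UVB]]]] := oB z Bz.
  by exists U, V, h; split=> // w Uw Vw hw; apply: BW; exact: UVB.
apply: filterS2 (zprod_near zU zV) (regular_at_neq0 _ _ (tensor_regular th) hz).
by move=> w [Uw Vw] hw; exact: UVW.
Qed.

(** The universal property of the product: a tensor pulls back to a sum of products
    of pulled back regular functions. *)
Lemma pair_morphism_at X Y Z (f : Z -> X) (g : Z -> Y) z :
  morphism_at f z -> morphism_at g z ->
  morphism_at (fun t => (f t, g t) : zprod X Y) z.
Proof.
move=> [cf rf] [cg rg].
have tr h : tensor_at ((f z, g z) : zprod X Y) h ->
    regular_at z (fun t => h (f t, g t)).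
  move=> [I [a [b [ra rb ->]]]]; apply: regular_at_sum => i.
  by apply: regular_atM; [exact: rf (ra i)|exact: rg (rb i)].
have cfg : {for z, continuous (fun t => (f t, g t) : zprod X Y)}.
  move=> W /zprod_nbhsP[U [V [h [zU zV th hz UVW]]]].
  have fU : nbhs z (f @^-1` U) := cf _ zU.
  have gV : nbhs z (g @^-1` V) := cg _ zV.
  apply: filterS3 fU gV (regular_at_neq0 _ _ (tr h th) hz).
  by move=> t Ut Vt ht; exact: (UVW (f t, g t)).
split=> // u [a [b [ta tb bz ab]]].
apply: (regular_at_germ _ (fun t => a (f t, g t) * (b (f t, g t))^-1)).
  have abz : nbhs z [set t | u (f t, g t) = a (f t, g t) / b (f t, g t)] := cfg _ ab.
  by apply: filterS abz => t /= ->.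
by apply: regular_atM (tr a ta) (regular_atV _ _ (tr b tb) bz).
Qed.

(** A tensor involves finitely many regular functions on each factor, so all of
    them extend along f and g on common neighbourhoods, and the tensor formed by
    their extensions restricts to the given one. *)
Lemma embedding_prod X X' Y Y' (f : X -> X') (g : Y -> Y') :
  sf_embedding f -> sf_embedding g ->
  sf_embedding (fun z : zprod X Y => (f z.1, g z.2) : zprod X' Y').
Proof.
move=> ef eg; have [fi nf rf] := ef; have [gi ng rg] := eg.
pose F : zprod X Y -> zprod X' Y' := fun z => (f z.1, g z.2).
rewrite -[sf_embedding _]/(sf_embedding F).
have mF z : morphism_at F z.
  apply: (pair_morphism_at (Z := zprod X Y) (f := f \o fst) (g := g \o snd)).
    by apply: morphism_at_comp; [exact: fst_morphism_at|exact: embedding_morphism_at].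
  by apply: morphism_at_comp; [exact: snd_morphism_at|exact: embedding_morphism_at].
have tF (z : zprod X Y) h : tensor_at z h -> exists h' U V,
    [/\ tensor_at (F z) h', nbhs z.1 U, nbhs z.2 V &
        forall w : zprod X Y, U w.1 -> V w.2 -> h w = h' (F w)].
  move=> [I [a [b [ra rb ->]]]].
  have /choice[a' a'E] : forall i, exists a',
      regular_at (f z.1) a' /\ \forall x \near z.1, a i x = a' (f x).
    by move=> i; have /rf[a' ? ?] := ra i; exists a'.
  have /choice[b' b'E] : forall i, exists b',
      regular_at (g z.2) b' /\ \forall y \near z.2, b i y = b' (g y).
    by move=> i; have /rg[b' ? ?] := rb i; exists b'.
  exists (fun w => \sum_i a' i w.1 * b' i w.2).
  exists [set x | forall i, a i x = a' i (f x)], [set y | forall i, b i y = b' i (g y)].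
  split.
  - by exists I, a', b'; split=> // i; [have [] := a'E i|have [] := b'E i].
  - by apply: filter_forall => i; have [] := a'E i.
  - by apply: filter_forall => i; have [] := b'E i.
  by move=> w aw bw; apply: eq_bigr => i _; rewrite aw bw.
split=> [z w [/fi e1 /gi e2]|z U|z u].
- by rewrite [z]surjective_pairing e1 e2 -surjective_pairing.
- split=> [|[W FW WU]]; last by apply: filterS WU _; have [+ _] := mF z; apply.
  move=> /zprod_nbhsP[A [B [h [zA zB /tF[h' [A' [B' [th' zA' zB' hh']]]] hz ABU]]]].
  have /nf[C fC CA] : nbhs z.1 (A `&` A') by exact: filterI.
  have /ng[D gD DB] : nbhs z.2 (B `&` B') by exact: filterI.
  exists [set w | [/\ C w.1, D w.2 & h' w != 0]].
    apply/zprod_nbhsP; exists C, D, h'; split=> //.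
    by rewrite -hh' //; exact: nbhs_singleton.
  move=> w [/CA[Aw A'w] /DB[Bw B'w] hw].
  by apply: ABU => //; rewrite hh'.
split=> [[a [b [/tF[a' [A [B [ta' zA zB aa']]]] /tF[b' [C [D [tb' zC zD bb']]]] bz ab]]]|].
  exists (fun w => a' w / b' w).
    exists a', b'; split=> //; last exact: near_all.
    by rewrite -bb' //; exact: nbhs_singleton.
  apply: filterS3 ab (zprod_near zA zB) (zprod_near zC zD) => w -> [? ?] [? ?].
  by rewrite aa' // bb'.
move=> [h rh uh]; have [_ /(_ h rh) rhF] := mF z.
by apply: (regular_at_germ _ _ _ _ rhF); apply: filterS uh.
Qed.

(** * Affine spaces *)

Section AffineSpace.
Variable V : vectType K.

Lemma poly_fun_regular (p : mpoly (\dim {:V}) K) (v : zariski V) :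
  regular_at v (poly_fun p : zariski V -> K).
Proof.
exists (poly_fun p), (fun=> 1); split.
- by exists p.
- by exists 1; apply/funext => w; rewrite /poly_fun meval1.
- exact: oner_neq0.
by apply: near_all => w; rewrite divr1.
Qed.

Lemma zariski_nbhsP (v : zariski V) (U : set (zariski V)) :
  nbhs v U <-> exists2 p, poly_fun p v != 0 & forall w, poly_fun p w != 0 -> U w.
Proof.
split=> [|[p pv pU]].
  rewrite nbhsE => -[B [/zariski_openP oB /oB[p [pv pB]]] BU].
  by exists p => // w /pB /BU.
by apply: filterS (regular_at_neq0 _ _ (poly_fun_regular p v) pv).
Qed.

Lemma coord_regular i (v : zariski V) :
  regular_at v (coord (vbasis {:V}) i : zariski V -> K).
Proof.
apply: (regular_at_germ _ _ _ _ (poly_fun_regular (mpolyX _ (mnm1 i)) v)).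
by apply: near_all => w; rewrite /poly_fun mevalXU.
Qed.

Lemma linear_regular (phi : {scalar V}) (v : zariski V) :
  regular_at v (phi : zariski V -> K).
Proof.
apply: (regular_at_germ _
  (fun w : zariski V => \sum_i coord (vbasis {:V}) i w * phi (vbasis {:V})`_i)).
  apply: near_all => w; rewrite [in RHS](coord_vbasis (memvf (w : V))) linear_sum.
  by apply: eq_bigr => i _; rewrite linearZ.
apply: regular_at_sum => i; apply: regular_atM (coord_regular i v) _.
exact: regular_at_cst.
Qed.

(** Affine space represents tuples of regular functions: a map into it is a
    morphism as soon as its coordinates are regular. *)
Lemma zariski_morphism_at X (f : X -> zariski V) x :
  (forall i, regular_at x (fun y => coord (vbasis {:V}) i (f y : V))) ->
  morphism_at f x.
Proof.
move=> rf.
have rp p : regular_at x (fun y => poly_fun p (f y)).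
  exact: (regular_at_meval p rf).
have cf : {for x, continuous f}.
  move=> U /zariski_nbhsP[p px pU].
  by apply: filterS (regular_at_neq0 _ _ (rp p) px) => y; exact: pU.
split=> // g [_ [_ [[p ->] [q ->] qx gE]]].
apply: (regular_at_germ _ (fun y => poly_fun p (f y) * (poly_fun q (f y))^-1)).
  have gEx : nbhs x [set y | g (f y) = poly_fun p (f y) / poly_fun q (f y)] := cf _ gE.
  by apply: filterS gEx => y /= ->.
exact: regular_atM (rp p) (regular_atV _ _ (rp q) qx).
Qed.

(** The form in which morphisms into affine spaces arise below: lines, and local
    sections of the incidence variety. *)
Lemma affine_combination_morphism_at X (I : Type) (r : seq I) (c : I -> X -> K)
    (v : V) (w : I -> V) x : (forall j, regular_at x (c j)) ->
  morphism_at (fun y => v + \sum_(j <- r) c j y *: w j : zariski V) x.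
Proof.
move=> rc; apply: zariski_morphism_at => i; pose f := coord (vbasis {:V}) i.
apply: (regular_at_germ _ (fun y => f v + \sum_(j <- r) c j y * f (w j))).
  apply: near_all => y; rewrite linearD linear_sum; congr (_ + _).
  by apply: eq_bigr => j _; rewrite linearZ.
apply: regular_atD; first exact: regular_at_cst.
apply: regular_at_sum => j; apply: regular_atM (rc j) _; exact: regular_at_cst.
Qed.

End AffineSpace.

Lemma linear_morphism_at (V W : vectType K) (phi : {linear V -> W}) (v : zariski V) :
  morphism_at (phi : zariski V -> zariski W) v.
Proof.
apply: zariski_morphism_at => i.
exact: (linear_regular (coord (vbasis {:W}) i \o phi)).
Qed.

Section LinearInjections.
Variables V W : vectType K.

Definition pair_l (v : V) : V * W := (v, 0).
Definition pair_r (w : W) : V * W := (0, w).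

Let pair_l_linear : linear pair_l.
Proof. by move=> c u v; congr pair; rewrite /= scaler0 addr0. Qed.
Let pair_r_linear : linear pair_r.
Proof. by move=> c u v; congr pair; rewrite /= scaler0 addr0. Qed.

HB.instance Definition _ :=
  GRing.isLinear.Build K V (V * W)%type *:%R pair_l pair_l_linear.
HB.instance Definition _ :=
  GRing.isLinear.Build K W (V * W)%type *:%R pair_r pair_r_linear.

End LinearInjections.

(** The identity is a morphism in both directions: into the vector space because
    its coordinates are sums of linear forms in either variable, and into the
    product because both projections are linear. *)
Lemma zprod_zariski (V W : vectType K) :
  sf_isomorphic (zprod (zariski V) (zariski W)) (zariski (V * W)%type).
Proof.
pose f (z : zprod (zariski V) (zariski W)) : zariski (V * W)%type := z.
pose g (z : zariski (V * W)%type) : zprod (zariski V) (zariski W) := z.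
exists f, g; split=> //; apply/sf_morphismP => z.
  apply: zariski_morphism_at => i; pose c := coord (vbasis {:(V * W)%type}) i.
  have [_ rl] := fst_morphism_at z; have [_ rr] := snd_morphism_at z.
  apply: (regular_at_germ _ _ _ _ (regular_atD _ _ _
    (rl _ (linear_regular (c \o @pair_l V W) _))
    (rr _ (linear_regular (c \o @pair_r V W) _)))).
  apply: near_all => -[v w] /=; rewrite -linearD; congr (c _).
  by congr pair; rewrite /= ?addr0 ?add0r.
rewrite [g](_ : _ = fun t : zariski (V * W)%type => (t.1, t.2)).
  by apply: pair_morphism_at; [exact: (linear_morphism_at fst)|
    exact: (linear_morphism_at snd)].
by apply/funext => -[].
Qed.

Lemma zariski_isomorphic (V W : vectType K) (phi : {linear V -> W})
    (psi : {linear W -> V}) : cancel phi psi -> cancel psi phi ->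
  sf_isomorphic (zariski V) (zariski W).
Proof.
by exists phi, psi; split=> //; apply/sf_morphismP => v; exact: linear_morphism_at.
Qed.

Lemma isomorphic_affine X Y :
  sf_isomorphic X Y -> affine_variety Y -> affine_variety X.
Proof.
move=> /isomorphic_embedding[f ef fT]; apply: embedding_affine ef _.
by rewrite fT; exact: closedT.
Qed.

Import VectorInternalTheory.

Lemma zariski_affine (V : vectType K) : affine_variety (zariski V).
Proof.
have [f ef fT] :=
  isomorphic_embedding (@zariski_isomorphic V _ v2r r2v v2rK r2vK).
by apply/affine_varietyP; exists (dim V), f; rewrite fT; split=> //; exact: closedT.
Qed.

Lemma morphism_preimage_closed X Y (f : X -> Y) (A : set Y) :
  (forall x, morphism_at f x) -> closed A -> closed (f @^-1` A).
Proof.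
move=> mf; have /continuous_closedP : continuous f by move=> x; have [] := mf x.
exact.
Qed.

Lemma affine_prod X Y :
  affine_variety X -> affine_variety Y -> affine_variety (zprod X Y).
Proof.
move=> /affine_varietyP[n [f [ef cf]]] /affine_varietyP[m [g [eg cg]]].
apply: (embedding_affine (embedding_prod ef eg)); last first.
  exact: isomorphic_affine (zprod_zariski _ _) (zariski_affine _).
set F := fun z => _.
rewrite (_ : range F = (fst : zprod (zariski 'rV[K]_n) (zariski 'rV[K]_m) -> _)
   @^-1` range f `&` snd @^-1` range g).
  apply: closedI; apply: morphism_preimage_closed => // z.
    exact: fst_morphism_at.
  exact: snd_morphism_at.
apply/seteqP; split=> [_ [[x y] _ <-]|[_ _] /= [[x _ <-] [y _ <-]]].
  by split; [exists x|exists y].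
by exists (x, y).
Qed.

(** * Prevarieties *)

Lemma prevariety_finType X (I : finType) (U : I -> set X) :
  (forall i, open (U i)) -> \bigcup_i U i = setT ->
  (forall i, affine_variety (set_type (U i))) -> prevariety X.
Proof.
move=> oU UT aU; exists #|I|, (fun j => U (enum_val j)); split=> //.
rewrite -subTset -UT => x [i _ Uix].
by exists (enum_rank i) => //; rewrite enum_rankK.
Qed.

Lemma affine_prevariety X : affine_variety X -> prevariety X.
Proof.
move=> aX; apply: (@prevariety_finType _ unit (fun=> setT)) => [_||_].
- exact: openT.
- by rewrite -subTset => x _; exists tt.
apply: (embedding_affine (set_val_embedding _)) aX.
by rewrite range_set_val; exact: closedT.
Qed.

(** The affine charts of Y pull back to charts of X: the preimage of a chart embeds
    into the chart, and its range there is the trace of the closed range of f. *)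
Lemma embedding_prevariety X Y (f : X -> Y) :
  sf_embedding f -> closed (range f) -> prevariety Y -> prevariety X.
Proof.
move=> ef cf [n [U [oU UT aU]]].
apply: (@prevariety_finType _ 'I_n (fun i => f @^-1` U i)) => [i||i].
- apply: open_comp (oU i) => x _.
  by have [] := embedding_morphism_at x ef.
- rewrite -subTset => x _; have [i _ Ui] : (\bigcup_i U i) (f x) by rewrite UT.
  by exists i.
have [g gE] : exists g : set_type (f @^-1` U i) -> set_type (U i),
    set_val \o g = f \o set_val.
  apply: sub_range_factor; rewrite range_set_val => _ [x _ <-].
  exact: (set_valP x).
have eg : sf_embedding g.
  apply: (embedding_factor (set_val_embedding (U i))); rewrite gE.
  exact: embedding_comp (set_val_embedding _) ef.
apply: embedding_affine eg _ (aU i).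
rewrite (_ : range g = set_val @^-1` range f).
  apply: morphism_preimage_closed cf => y.
  exact: embedding_morphism_at (set_val_embedding _).
apply/seteqP; split=> [_ [x _ <-]|y [x _ xy]].
  by exists (set_val x) => //; rewrite -[RHS]/((set_val \o g) x) gE.
have Ux : (f @^-1` U i) x by rewrite /preimage /= xy; exact: set_valP.
exists (SigSub (mem_set Ux)) => //; apply: val_inj.
by rewrite -[LHS]/((set_val \o g) _) gE.
Qed.

(** The box on two affine charts, with the structure induced from the product, is
    the product of the charts: both embed into the product with the same range. *)
Lemma prevariety_prod X Y : prevariety X -> prevariety Y -> prevariety (zprod X Y).
Proof.
move=> [n [U [oU UT aU]]] [m [V [oV VT aV]]].
pose W (k : 'I_n * 'I_m) : set (zprod X Y) := [set z | U k.1 z.1 /\ V k.2 z.2].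
apply: (@prevariety_finType _ _ W) => [k||k].
- apply/open_nbhsP => z [Uz Vz].
  by apply: zprod_near; exact: open_nbhs_nbhs.
- rewrite -subTset => z _.
  have [i _ Ui] : (\bigcup_i U i) z.1 by rewrite UT.
  have [j _ Vj] : (\bigcup_j V j) z.2 by rewrite VT.
  by exists (i, j).
pose G (w : zprod (set_type (U k.1)) (set_type (V k.2))) : zprod X Y :=
  (set_val w.1, set_val w.2).
have eG : sf_embedding G by exact: embedding_prod (set_val_embedding _) (set_val_embedding _).
have [g gE] : exists g, G \o g = @set_val _ (W k).
  apply: sub_range_factor; rewrite range_set_val => -[x y] [/= Ux Vy].
  by exists (SigSub (mem_set Ux), SigSub (mem_set Vy)).
have eg : sf_embedding g.
  by apply: (embedding_factor eG); rewrite gE; exact: set_val_embedding.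
apply: embedding_affine eg _ (affine_prod (aU k.1) (aV k.2)).
rewrite (_ : range g = setT); first exact: closedT.
rewrite -subTset => w _.
have Ww : W k (G w) by split; exact: set_valP.
exists (SigSub (mem_set Ww)) => //; have [Gi _ _] := eG; apply: Gi.
by rewrite -[LHS]/((G \o g) _) gE.
Qed.

(** * Separation *)

(** Separatedness in the form in which it is inherited: the locus where two
    morphisms differ is open, as a preimage of the complement of the diagonal. *)
Lemma separated_near_neq X Z (f g : Z -> X) z : separated_space X ->
  morphism_at f z -> morphism_at g z -> f z <> g z ->
  \forall t \near z, f t <> g t.
Proof.
move=> sX mf mg fg; have [cfg _] := pair_morphism_at mf mg.
apply: (cfg (~` [set w | w.1 = w.2])); apply: open_nbhs_nbhs; split=> //.
exact: closed_openC.
Qed.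

Lemma separatedP X : separated_space X <->
  forall z : zprod X X, z.1 <> z.2 -> \forall t \near z, t.1 <> t.2.
Proof.
split=> [sX z|H].
  by apply: separated_near_neq sX _ _; [exact: fst_morphism_at|exact: snd_morphism_at].
rewrite /separated_space -[X in closed X]setCK; apply: open_closedC.
by apply/open_nbhsP => z /H.
Qed.

Lemma separated_injective X Y (f : X -> Y) :
  (forall x, morphism_at f x) -> injective f ->
  separated_space Y -> separated_space X.
Proof.
move=> mf fi sY; apply/separatedP => z zneq.
have : \forall t \near z, f t.1 <> f t.2.
  apply: (@separated_near_neq Y (zprod X X) (fun t => f t.1) (fun t => f t.2) z sY).
  - exact: morphism_at_comp (fst_morphism_at z) (mf _).
  - exact: morphism_at_comp (snd_morphism_at z) (mf _).
  - by move=> /= /fi.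
by apply: filterS => t ft e; apply: ft; rewrite e.
Qed.

Lemma separated_prod X Y :
  separated_space X -> separated_space Y -> separated_space (zprod X Y).
Proof.
pose XY : sfType K := zprod X Y.
move=> sX sY; apply/separatedP => z zneq.
have [e1|n1] := pselect (z.1.1 = z.2.1).
  have : \forall t \near z, t.1.2 <> t.2.2.
    apply: (@separated_near_neq Y (zprod XY XY) (fun t => t.1.2) (fun t => t.2.2) z sY).
    - exact: morphism_at_comp (fst_morphism_at z) (snd_morphism_at _).
    - exact: morphism_at_comp (snd_morphism_at z) (snd_morphism_at _).
    - move=> /= e2; apply: zneq.
      by rewrite [LHS]surjective_pairing e1 e2 -surjective_pairing.
  by apply: filterS => t ft e; apply: ft; rewrite e.
have : \forall t \near z, t.1.1 <> t.2.1.
  apply: (@separated_near_neq X (zprod XY XY) (fun t => t.1.1) (fun t => t.2.1) z sX) => //.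
  - exact: morphism_at_comp (fst_morphism_at z) (fst_morphism_at _).
  - exact: morphism_at_comp (snd_morphism_at z) (fst_morphism_at _).
by apply: filterS => t ft e; apply: ft; rewrite e.
Qed.

Lemma zariski_separated (V : vectType K) : separated_space (zariski V).
Proof.
apply/separatedP => z zneq; pose c i := coord (vbasis {:V}) i : V -> K.
have [i ci] : exists i, c i z.1 - c i z.2 != 0.
  apply: contrapT => /forallNP H; apply: zneq.
  rewrite (coord_vbasis (memvf (z.1 : V))) (coord_vbasis (memvf (z.2 : V))).
  apply: eq_bigr => i _; congr (_ *: _).
  by apply/eqP; rewrite -subr_eq0; apply/negPn/negP; exact: H.
have [_ r1] := fst_morphism_at z; have [_ r2] := snd_morphism_at z.
have rd : regular_at z (fun t : zprod (zariski V) (zariski V) => c i t.1 - c i t.2).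
  apply: (regular_at_germ _ _ _ _ (regular_atD _ _ _ (r1 _ (coord_regular i _))
    (regular_atM _ _ _ (regular_at_cst z (-1)) (r2 _ (coord_regular i _))))).
  by apply: near_all => t; rewrite mulN1r.
apply: filterS (regular_at_neq0 _ _ rd ci) => t + e.
by rewrite e subrr eqxx.
Qed.

Lemma affine_space_variety (V : vectType K) : variety (zariski V).
Proof.
split; last exact: zariski_separated.
exact: affine_prevariety (zariski_affine V).
Qed.

Lemma variety_prod X Y : variety X -> variety Y -> variety (zprod X Y).
Proof.
by move=> [pX sX] [pY sY]; split; [exact: prevariety_prod|exact: separated_prod].
Qed.

Lemma closed_subvariety X (S : set X) : variety X -> closed S -> variety (set_type S).
Proof.
move=> [pX sX] cS; have eS := set_val_embedding S; split.
  by apply: embedding_prevariety eS _ pX; rewrite range_set_val.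
apply: (separated_injective (f := set_val)) sX; last exact: val_inj.
by move=> x; exact: embedding_morphism_at.
Qed.

End Products.

(** * Irreducibility *)

(** Irreducibility of a subset in terms of traces of open sets of the ambient
    space: nonempty ones always meet. *)
Definition irreducible_set (T : topologicalType) (S : set T) : Prop :=
  S !=set0 /\ forall U V : set T, open U -> open V ->
    S `&` U !=set0 -> S `&` V !=set0 -> S `&` (U `&` V) !=set0.

Section Irreducibility.
Implicit Types T B : topologicalType.

Lemma irreducible_spaceP T : irreducible_space T <-> irreducible_set [set: T].
Proof.
split=> -[T0 H]; split=> // A B.
  move=> oA oB; rewrite !setTI => A0 B0; apply: contrapT => AB.
  have [||||] := H (~` A) (~` B); try exact: open_closedC.
  - by rewrite -setCI; apply/seteqP; split=> // x _ ABx; apply: AB; exists x.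
  - by move=> /seteqP[_ nA]; have [a Aa] := A0; exact: nA Aa.
  - by move=> /seteqP[_ nB]; have [b Bb] := B0; exact: nB Bb.
move=> cA cB AB; apply: contrapT => /not_orP[nA nB].
have nT (D : set T) : D <> setT -> ~` D !=set0.
  move=> nD; apply: contrapT => nC; apply: nD; rewrite -subTset => x _.
  by apply: contrapT => nDx; apply: nC; exists x.
have := H (~` A) (~` B) (closed_openC cA) (closed_openC cB).
rewrite !setTI => /(_ (nT _ nA) (nT _ nB))[x [nAx nBx]].
by have [] : (A `|` B) x by rewrite AB.
Qed.

Lemma irreducible_set_type T (S : set T) :
  irreducible_set S -> irreducible_space (set_type S).
Proof.
move=> [[x Sx] H]; apply/irreducible_spaceP; split.
  by exists (SigSub (mem_set Sx)).
move=> _ _ [U oU <-] [V oV <-]; rewrite !setTI => -[u Uu] [v Vv].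
have [||y [Sy [Uy Vy]]] := H U V oU oV.
- by exists (set_val u); split; [exact: set_valP|].
- by exists (set_val v); split; [exact: set_valP|].
by exists (SigSub (mem_set Sy)).
Qed.

Lemma irreducible_image T B (f : T -> B) (S : set T) :
  continuous f -> irreducible_set S -> irreducible_set (f @` S).
Proof.
move=> /continuousP cf [[s Ss] H]; split; first by exists (f s), s.
move=> U V oU oV [_ [[x Sx <-] Ux]] [_ [[y Sy <-] Vy]].
have [||z [Sz [Uz Vz]]] := H _ _ (cf _ oU) (cf _ oV); first by exists x.
  by exists y.
by exists (f z); split=> //; exists z.
Qed.

Lemma irreducible_closure T (S : set T) :
  irreducible_set S -> irreducible_set (closure S).
Proof.
move=> [[s Ss] H]; split; first by exists s; exact: subset_closure.
have meet U : open U -> closure S `&` U !=set0 -> S `&` U !=set0.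
  by move=> oU [x [Sx Ux]]; apply: Sx; exact: open_nbhs_nbhs.
move=> U V oU oV /(meet _ oU) SU /(meet _ oV) SV.
by have [x [Sx UVx]] := H U V oU oV SU SV; exists x; split=> //; exact: subset_closure.
Qed.

(** The images of two nonempty open subsets of S contain open sets of the base,
    which meet; above a common point both subsets are nonempty open in one fibre. *)
Lemma irreducible_fibration T B (pi : T -> B) (S : set T) :
  irreducible_space B ->
  (forall b, irreducible_set (S `&` pi @^-1` [set b])) ->
  (forall s U, S s -> nbhs s U -> nbhs (pi s) (pi @` (S `&` U))) ->
  irreducible_set S.
Proof.
move=> /irreducible_spaceP[[b _] HB] fib opi; split.
  by have [[s [Ss _]] _] := fib b; exists s.
move=> U V oU oV [x [Sx Ux]] [y [Sy Vy]].
have nU := opi _ _ Sx (open_nbhs_nbhs (conj oU Ux)).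
have nV := opi _ _ Sy (open_nbhs_nbhs (conj oV Vy)).
have [||c] := HB _ _ (open_interior (pi @` (S `&` U))) (open_interior (pi @` (S `&` V))).
- by exists (pi x).
- by exists (pi y).
move=> [_ [/interior_subset[u [Su Uu] uc] /interior_subset[v [Sv Vv] vc]]].
have [_ /(_ U V oU oV)[||z [[Sz _] UVz]]] := fib c; [by exists u|by exists v|].
by exists z.
Qed.

End Irreducibility.

Section AffineIrreducibility.
Variables (K : closedFieldType) (V : vectType K).

Lemma poly_fun_line (p : mpoly (\dim {:V}) K) (v w : V) :
  exists q : {poly K}, forall t : K,
    poly_fun p (v + t *: w : zariski V) = q.[t].
Proof.
pose l i : {poly K} := (coord (vbasis {:V}) i v)%:P + coord (vbasis {:V}) i w *: 'X.
exists (\sum_(m <- msupp p) mcoeff m p *: \prod_i l i ^+ fun_of_multinom m i) => t.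
rewrite /poly_fun mevalE horner_sum; apply: eq_bigr => m _.
rewrite hornerZ horner_prod; congr (_ * _); apply: eq_bigr => i _.
by rewrite horner_exp hornerD hornerC hornerZ hornerX linearD linearZ mulrC.
Qed.

(** On the line joining a point where p is nonzero to one where q is nonzero, both
    restrict to nonzero polynomials in one variable, and over an algebraically
    closed field their product has a point where it does not vanish. *)
Lemma zariski_irreducible : irreducible_set [set: zariski V].
Proof.
split; first by exists (0 : V).
move=> A B /zariski_openP oA /zariski_openP oB.
rewrite !setTI => -[v /oA[p [pv pA]]] [w /oB[q [qw qB]]].
have [P PE] := poly_fun_line p v (w - v : V).
have [Q QE] := poly_fun_line q v (w - v : V).
have /closed_nonrootP[t] : P * Q != 0.
  rewrite mulf_neq0 //.
    by apply: contraNneq pv => P0; rewrite -[v]addr0 -(scale0r (w - v : V)) PE P0 horner0.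
  apply: contraNneq qw => Q0.
  by rewrite -[w](addrNK v) addrC -[X in _ + X]scale1r QE Q0 horner0.
rewrite rootM negb_or /root => /andP[Pt Qt].
by exists (v + t *: (w - v : V)); split; [apply: pA; rewrite PE|apply: qB; rewrite QE].
Qed.

End AffineIrreducibility.

(** * The incidence variety *)

Lemma chart_around (K : closedFieldType) (X : sfType K) (L : line_bundle X) (x : X) :
  exists a : chart L, trivial_on a x.
Proof.
have [a _ ax] : (\bigcup_a @trivial_on _ _ L a) x by rewrite trivial_on_cover.
by exists a.
Qed.

Section Sections.
Variables (K : closedFieldType) (X : sfType K) (L : line_bundle X) (E : linear_series L).

Definition chart_value (a : chart L) (x : X) (s : E) : K :=
  triv a x (series_incl E s x).

Fact chart_value_scalar a x : scalar (chart_value a x).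
Proof.
move=> c s t; rewrite /chart_value linearP.
rewrite -[section_eval _ _]/(c *: series_incl E s x + series_incl E t x).
by rewrite linearP.
Qed.

HB.instance Definition _ a x :=
  GRing.isLinear.Build K E K *%R (chart_value a x) (chart_value_scalar a x).

Lemma chart_value_regular a x (s : E) :
  trivial_on a x -> regular_at x (fun y => chart_value a y s).
Proof. by move=> ax; have /asboolP := section_regular (series_incl E s); apply. Qed.

Lemma chart_value_eq0 a x (s : E) :
  trivial_on a x -> chart_value a x s = 0 <-> series_incl E s x = 0.
Proof.
move=> ax; split=> [|s0]; last by rewrite /chart_value s0 linear0.
by rewrite -(linear0 (triv a x)) => /(bij_inj (triv_bij ax)).
Qed.

(** The only use of base-point freeness: it supplies the denominators of the local
    sections of the incidence variety. *)
Lemma base_point_free_chart x : base_point_free E ->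
  exists (a : chart L) (s : E), trivial_on a x /\ chart_value a x s != 0.
Proof.
move=> bE; have [a ax] := chart_around L x.
have /existsNP[s sx] : ~ forall s : E, series_incl E s x = 0.
  by move=> H; apply: bE; exists x.
by exists a, s; split=> //; apply/eqP => /(chart_value_eq0 _ ax).
Qed.

End Sections.

Section DepfunComponents.
Variables (K : fieldType) (I : finType) (V : I -> vectType K).

Definition component i (f : depfun (fun i => V i)) : V i := f i.

Fact component_linear i : linear (component i).
Proof. by []. Qed.

HB.instance Definition _ i :=
  GRing.isLinear.Build K (depfun (fun i => V i)) (V i) *:%R
    (component i) (component_linear i).

Definition supported_at i (v : V i) : depfun (fun i => V i) :=
  dfwith (fun j => 0 : V j) v.

Lemma component_sum_supported (c : I -> K) (v : forall i, V i) i :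
  component i (\sum_j c j *: supported_at (v j)) = c i *: v i.
Proof.
rewrite linear_sum (bigD1 i) //= linearZ /= big1 => [|j ji].
  by rewrite addr0 /component /supported_at dfwith_in.
by rewrite linearZ /= /component /supported_at dfwith_out // scaler0.
Qed.

End DepfunComponents.

Section Incidence.
Variables (K : closedFieldType) (X : sfType K) (k : nat).
Variables (L : 'I_k -> line_bundle X) (E : forall i, linear_series (L i)).
Local Notation V := (system_space E).
Local Notation R := (incidence_variety E).

(** In a chart around z.1, the value at y of the i-th member of a system w is the
    sum of the coordinates of w_i times the values at y of a basis of E_i, a
    function regular in (y, w); so being nonzero is an open condition. *)
Lemma incidence_closed : closed R.
Proof.
rewrite -[R]setCK; apply: open_closedC; apply/open_nbhsP => z /existsNP[i zi].
have [a ax] := chart_around (L i) z.1.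
pose b := vbasis {:E i}.
pose h (w : zprod X (zariski V)) :=
  \sum_j coord b j (component i w.2) * chart_value a w.1 b`_j.
have hE w : h w = chart_value a w.1 (component i w.2).
  rewrite [in RHS](coord_vbasis (memvf (component i w.2))) linear_sum.
  by apply: eq_bigr => j _; rewrite linearZ.
have rh : regular_at z h.
  have [_ r1] := fst_morphism_at z; have [_ r2] := snd_morphism_at z.
  apply: regular_at_sum => j; apply: regular_atM.
    exact: r2 _ (linear_regular (coord b j \o component i) _).
  exact: r1 _ (chart_value_regular _ ax).
have hz : h z != 0 by rewrite hE; apply/eqP => /(chart_value_eq0 _ ax).
have na : nbhs z.1 (trivial_on a).
  by apply: open_nbhs_nbhs; split=> //; exact: trivial_on_open.
have za : nbhs z [set w : zprod X (zariski V) | trivial_on a w.1].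
  by have [cf _] := fst_morphism_at z; exact: cf.
apply: filterS2 za (regular_at_neq0 _ _ rh hz) => w wa hw wR.
by move/eqP: hw; apply; rewrite hE; apply/(chart_value_eq0 _ wa); exact: wR.
Qed.

(** The fibre is a linear space, and the line through two of its points pulls back
    two nonempty open sets to nonempty open subsets of the affine line. *)
Lemma incidence_fiber_irreducible x : irreducible_set (R `&` fst @^-1` [set x]).
Proof.
split=> [|A B oA oB].
  exists (x, 0 : V); split=> // i /=; rewrite -[(0 : V) i]/(component i 0).
  by rewrite !linear0.
move=> [[x1 v] [[Rv /= x1x] Av]] [[x2 w] [[Rw /= x2x] Bw]]; subst x1 x2.
(* The sum over one index only serves to use affine_combination_morphism_at. *)
pose l (t : zariski K^o) : zprod X (zariski V) :=
  (x, v + \sum_(j <- [:: tt]) t *: (w - v : V)).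
have ml t : morphism_at l t.
  apply: pair_morphism_at; first exact: morphism_at_cst.
  apply: (@affine_combination_morphism_at K V (zariski K^o) unit [:: tt]
    (fun=> id) v (fun=> w - v : V)) => _.
  exact: (linear_regular (idfun : {scalar K^o})).
have /continuousP cl : continuous l by move=> t; have [] := ml t.
have lE t : l t = (x, v + t *: (w - v : V)) by rewrite /l big_seq1.
have [_ /(_ _ _ (cl _ oA) (cl _ oB))] := zariski_irreducible K^o.
rewrite !setTI => -[||t [At Bt]].
- by exists (0 : K^o); rewrite /preimage /= lE scale0r addr0.
- by exists (1 : K^o); rewrite /preimage /= lE scale1r addrC subrK.
exists (l t); split=> //; split; last by rewrite lE.
move=> i; rewrite lE /=.
rewrite -[series_incl _ _]/(series_incl (E i)
  (component i v + t *: (component i w - component i v))).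
have [a ax] := chart_around (L i) x; apply/(chart_value_eq0 _ ax).
have va : chart_value a x (component i v) = 0 by apply/(chart_value_eq0 _ ax); exact: Rv.
have wa : chart_value a x (component i w) = 0 by apply/(chart_value_eq0 _ ax); exact: Rw.
by rewrite linearD linearZ linearB /= va wa subrr mulr0 addr0.
Qed.

(** A local section l through z, whose i-th component at y is
    v_i - (v_i(y) / e_i(y)) e_i with e_i(x) nonzero, moves into U near x. *)
Lemma incidence_projection_open (z : zprod X (zariski V))
    (U : set (zprod X (zariski V))) :
  (forall i, base_point_free (E i)) -> R z -> nbhs z U ->
  nbhs z.1 (fst @` (R `&` U)).
Proof.
case: z => x v bE Rz zU /=.
pose aP i := cid (base_point_free_chart x (bE i)); pose a i := projT1 (aP i).
pose eP i := cid (projT2 (aP i)); pose e i := projT1 (eP i).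
have ax i : trivial_on (a i) x by have [] := projT2 (eP i).
have ex i : chart_value (a i) x (e i) != 0 by have [] := projT2 (eP i).
pose c i y := - (chart_value (a i) y (component i v) / chart_value (a i) y (e i)).
pose l y : zprod X (zariski V) :=
  (y, v + \sum_i c i y *: supported_at (V := fun i => E i) (e i)).
have ml : morphism_at l x.
  apply: pair_morphism_at; first exact: morphism_at_id.
  apply: affine_combination_morphism_at => i.
  apply: (regular_at_germ _ _ _ _ (regular_atM _ _ _ (regular_at_cst x (-1))
    (regular_atM _ _ _ (chart_value_regular (component i v) (ax i))
      (regular_atV _ _ (chart_value_regular (e i) (ax i)) (ex i))))).
  by apply: near_all => y; rewrite mulN1r.
have lx : l x = (x, v).
  rewrite /l big1 ?addr0 // => i _; rewrite /c.
  have -> : chart_value (a i) x (component i v) = 0.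
    by apply/(chart_value_eq0 _ (ax i)); exact: Rz.
  by rewrite mul0r oppr0 scale0r.
have lU : nbhs x (l @^-1` U) by have [cl _] := ml; apply: cl; rewrite lx.
have near_chart : \forall y \near x, forall i, trivial_on (a i) y.
  apply: filter_forall => i; apply: open_nbhs_nbhs.
  by split=> //; exact: trivial_on_open.
have near_neq0 : \forall y \near x, forall i, chart_value (a i) y (e i) != 0.
  apply: filter_forall => i.
  exact: regular_at_neq0 (chart_value_regular (e i) (ax i)) (ex i).
apply: filterS3 lU near_chart near_neq0 => y Uy ay ey.
exists (l y) => //; split=> // i; apply/(chart_value_eq0 _ (ay i)).
rewrite -[X in chart_value _ _ X]/(component i v + component i
  (\sum_i c i y *: supported_at (V := fun i => E i) (e i))).
by rewrite component_sum_supported linearD linearZ /= mulNr divfK // subrr.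
Qed.

End Incidence.

Theorem theorem2p1 (R : realType) (X : sfType (complex.complex R))
    (hX : irreducible_variety X)
    (k : nat) (L : 'I_k -> line_bundle X)
    (hL : forall i : 'I_k, globally_generated (L i))
    (E : forall i : 'I_k, linear_series (L i))
    (hE : forall i : 'I_k, base_point_free (E i)) :
  irreducible_subvariety (incidence_variety E) /\
  irreducible_subvariety (consistency_variety E).
Proof.
have [vX iX] := hX.
have iR : irreducible_set (incidence_variety E).
  apply: (irreducible_fibration (pi := fst : zprod X _ -> X)) iX _ _.
    exact: incidence_fiber_irreducible.
  by move=> z U; exact: incidence_projection_open.
have vE := affine_space_variety (system_space E).
split; split.
- exact: incidence_closed.
- split; last exact: irreducible_set_type.
  exact: closed_subvariety (variety_prod vX vE) (incidence_closed (E := E)).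
- exact: closed_closure.
- split; first exact: (closed_subvariety vE (@closed_closure _ _)).
  apply/irreducible_set_type/irreducible_closure/irreducible_image => //.
  by move=> z; have [] := snd_morphism_at z.
Qed.
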